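(* Let $(V,\top)$ be a locality vector space and let $W,\widetilde W$ be two linear subspaces of $V$ with $W\oplus\widetilde W=V$. Then $W$ and $\widetilde W$ are strong locality complements if and only if, in the split short exact sequence $$0\to W\overset{\iota}{\to}V\overset{\widetilde\pi}{\to}\widetilde W\to0,$$ where $\iota$ is the inclusion, $\widetilde\pi$ is the projection onto $\widetilde W$ along $W$, and the sequence is split by the projection $\pi:V\to W$ along $\widetilde W$ (so $\pi\circ\iota={\rm Id}_W$), the maps $\pi$ and $\widetilde\pi$ satisfy one of the following equivalent conditions, where ${\rm Id}_V=\pi+\widetilde\pi$: 1. $\pi\top\pi$ and $\pi\top\widetilde\pi$; 2. $\pi\top{\rm Id}_V$; 3. $\widetilde\pi\top\widetilde\pi$ and $\pi\top\widetilde\pi$; 4. $\widetilde\pi\top{\rm Id}_V$. Furthermore, in this case $(V/W,\overline\top)$ is a locality vector space isomorphic (as a locality vector space) to $(\widetilde W,\top\cap(\widetilde W\times\widetilde W))$.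
   Context: The ground field is $\mathbb{R}$ or $\mathbb{C}$. A locality vector space is a vector space $V$ with a symmetric relation $\top\subset V\times V$ containing $(0,0)$ such that for every subset $U\subset V$ the polar set $U^\top=\{x\in V: x\top u\ \forall u\in U\}$ is a linear subspace. For maps $\varphi,\psi:V\to V$, $\varphi\top\psi$ means: $x\top y$ implies $\varphi(x)\top\psi(y)$; maps with values in subspaces of $V$ are regarded as maps to $V$. A strong locality complement of a subspace $W$ of $(V,\top)$ is a subspace $\widetilde W$ with $W\oplus\widetilde W=V$ such that one of the (equivalent) conditions 1-4 holds for the projections $\pi$ onto $W$ along $\widetilde W$ and $\widetilde\pi$ onto $\widetilde W$ along $W$; then $W,\widetilde W$ are called strong locality complements. The quotient locality $\overline\top$ on $V/W$: $[u]\,\overline\top\,[v]$ iff there exist $u'\in[u]$, $v'\in[v]$ with $u'\top v'$. An isomorphism of locality vector spaces is an invertible linear map which, together with its inverse, sends related pairs to related pairs. *)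

(* Defs.v *)
From HB Require Import structures.
From mathcomp Require Import all_boot all_algebra.
From mathcomp Require Import generic_quotient ring_quotient.
From mathcomp Require Import boolp classical_sets reals complex.

Set Implicit Arguments.
Unset Strict Implicit.
Unset Printing Implicit Defensive.

Import GRing.Theory.
Local Open Scope classical_set_scope.
Local Open Scope quotient_scope.
Local Open Scope ring_scope.

Variant ground := GroundReal | GroundComplex.

Definition ground_field (R : realType) (g : ground) : fieldType :=
  match g with
  | GroundReal => R
  | GroundComplex => complex R
  end.

(* In an lmodType V of arbitrary dimension, a linear subspace is a bundled      *)
(* predicate W : submodClosed V; subspace W is its carrier as an lmodType.      *)
Section Subspace.
Variables (K : fieldType) (V : lmodType K) (W : submodClosed V).

Record subspace := Subspace { incl : V; inclP : incl \in W }.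

HB.instance Definition _ := [isSub for incl].
HB.instance Definition _ := [Choice of subspace by <:].
HB.instance Definition _ := [SubChoice_isSubLmodule of subspace by <:].

Fact incl_is_linear : linear incl.
Proof. exact: (@linearP _ _ _ _ (val : {linear subspace -> V})). Qed.

HB.instance Definition _ := GRing.isLinear.Build K subspace V *:%R incl
  incl_is_linear.

End Subspace.

Section SubspaceTheory.
Variables (K : fieldType) (V : lmodType K) (W : submodClosed V).

Lemma subspaceN v : v \in W -> - v \in W.
Proof. by move=> vW; rewrite -scaleN1r rpredZ. Qed.

Lemma subspaceB u v : u \in W -> v \in W -> u - v \in W.
Proof. by move=> uW vW; rewrite rpredD ?subspaceN. Qed.

(* submodClosed does not inherit from zmodClosed, which Quotient.quot needs.    *)
Definition subspace_zmod : {pred V} := fun v => v \in W.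

Fact subspace_zmod_closed : zmod_closed subspace_zmod.
Proof.
by split=> [|u v]; [exact: (rpred0 W) | exact: (@subspaceB u v)].
Qed.

HB.instance Definition _ := GRing.isZmodClosed.Build V subspace_zmod
  subspace_zmod_closed.

End SubspaceTheory.

(* Quotient.quot only carries the additive group structure of the quotient.     *)
Section QuotientSpace.
Variables (K : fieldType) (V : lmodType K) (W : submodClosed V).

Definition qspace := Quotient.quot (subspace_zmod W).
HB.instance Definition _ := GRing.Zmodule.on qspace.
HB.instance Definition _ := EqQuotient.on qspace.

Definition qclass (v : V) : qspace := \pi_qspace v.

Lemma qclassP u v : (qclass u = qclass v) <-> (u - v \in W).
Proof.
rewrite -[_ \in W]/(u - v \in subspace_zmod W) Quotient.idealrBE.
by split=> /eqP.
Qed.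

Lemma qclass_surj a : exists u, qclass u = a.
Proof. by exists (repr a); rewrite /qclass reprK. Qed.

Definition qscale (k : K) (a : qspace) : qspace := qclass (k *: repr a).

Lemma qclassZ k v : qscale k (qclass v) = qclass (k *: v).
Proof.
apply/qclassP; rewrite -scalerBr rpredZ //; apply/qclassP.
by rewrite /qclass reprK.
Qed.

Lemma qclassD u v : qclass (u + v) = qclass u + qclass v.
Proof. exact: (raddfD \pi_qspace). Qed.

Fact qscaleA k l a : qscale k (qscale l a) = qscale (k * l) a.
Proof. by case: (qclass_surj a) => u <-; rewrite !qclassZ scalerA. Qed.

Fact qscale1 : left_id 1 qscale.
Proof. by move=> a; case: (qclass_surj a) => u <-; rewrite qclassZ scale1r. Qed.

Fact qscaleDr : right_distributive qscale +%R.
Proof.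
move=> k a b; case: (qclass_surj a) (qclass_surj b) => u <- [v <-].
by rewrite -qclassD !qclassZ scalerDr qclassD.
Qed.

Fact qscaleDl a : {morph qscale^~ a : k l / k + l}.
Proof.
by move=> k l; case: (qclass_surj a) => u <-; rewrite !qclassZ scalerDl qclassD.
Qed.

HB.instance Definition _ := GRing.Zmodule_isLmodule.Build K qspace
  qscaleA qscale1 qscaleDr qscaleDl.

Fact qclass_is_linear : linear qclass.
Proof. by move=> k u v; rewrite qclassD -qclassZ. Qed.

HB.instance Definition _ := GRing.isLinear.Build K V qspace *:%R qclass
  qclass_is_linear.

End QuotientSpace.

Arguments incl {K V} W _.
Arguments qclass {K V} W _.

Section DirectSum.
Variables (K : fieldType) (V : lmodType K).

Definition direct_sum (W W' : submodClosed V) : Prop :=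
  (forall v : V, exists w w', [/\ w \in W, w' \in W' & v = w + w']) /\
  (forall v : V, v \in W -> v \in W' -> v = 0).

Lemma direct_sumC W W' : direct_sum W W' -> direct_sum W' W.
Proof.
case=> s d; split=> [v|v vW' vW]; last exact: d.
by have [w [w' [wW w'W' ->]]] := s v; exists w', w; rewrite addrC.
Qed.

Section Projection.
Variables (W W' : submodClosed V) (dWW' : direct_sum W W').

Fact proj_subproof v : exists w : subspace W, v - incl W w \in W'.
Proof.
have [w [w' [wW w'W' ->]]] := dWW'.1 v.
by exists (Subspace wW); rewrite /= addrAC subrr add0r.
Qed.

(* the projection onto W along W' *)
Definition proj (v : V) : subspace W := sval (cid (proj_subproof v)).

Lemma projP v : v - incl W (proj v) \in W'.
Proof. exact: svalP (cid (proj_subproof v)). Qed.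

Lemma proj_unique v (w : subspace W) : v - incl W w \in W' -> proj v = w.
Proof.
move=> vw; apply: val_inj; rewrite /=; apply/subr0_eq; apply: dWW'.2.
  by rewrite subspaceB ?inclP.
have -> : incl W (proj v) - incl W w = (v - incl W w) - (v - incl W (proj v)).
  by rewrite opprB [RHS]addrC addrA subrK.
by rewrite subspaceB ?projP.
Qed.

Fact proj_is_linear : linear proj.
Proof.
move=> k u v; apply: proj_unique.
by rewrite incl_is_linear opprD addrACA -scalerBr rpredD ?rpredZ ?projP.
Qed.

HB.instance Definition _ := GRing.isLinear.Build K V (subspace W) *:%R proj
  proj_is_linear.

End Projection.
End DirectSum.

Definition short_exact (K : fieldType) (A B C : lmodType K)
    (f : {linear A -> B}) (g : {linear B -> C}) : Prop :=
  [/\ injective f, range f = [set b | g b = 0] & range g = setT].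

Section Locality.
Variable K : fieldType.

Definition polar (V : lmodType K) (T : V -> V -> Prop) (U : set V) : set V :=
  [set x | forall u, U u -> T x u].

Definition locality (V : lmodType K) (T : V -> V -> Prop) : Prop :=
  [/\ T 0 0, forall x y, T x y -> T y x
    & forall U : set V, submod_closed [in polar T U]].

Definition local_maps (V : lmodType K) (T : V -> V -> Prop) (f g : V -> V) :=
  forall x y, T x y -> T (f x) (g y).

Definition locality_isomorphic (V V' : lmodType K)
    (T : V -> V -> Prop) (T' : V' -> V' -> Prop) : Prop :=
  exists (f : {linear V -> V'}) (g : {linear V' -> V}),
    [/\ cancel f g, cancel g f,
        forall x y, T x y -> T' (f x) (f y)
      & forall x y, T' x y -> T (g x) (g y)].

Section SubQuot.
Variables (V : lmodType K) (T : V -> V -> Prop) (W : submodClosed V).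

Definition sub_rel (x y : subspace W) : Prop := T (incl W x) (incl W y).

Definition quot_rel (a b : qspace W) : Prop :=
  exists u' v', [/\ qclass W u' = a, qclass W v' = b & T u' v'].

End SubQuot.

Section StrongComplement.
Variables (V : lmodType K) (T : V -> V -> Prop).

Definition cond1 (p p' : V -> V) : Prop := local_maps T p p /\ local_maps T p p'.
Definition cond2 (p : V -> V) : Prop := local_maps T p idfun.
Definition cond3 (p p' : V -> V) : Prop :=
  local_maps T p' p' /\ local_maps T p p'.
Definition cond4 (p' : V -> V) : Prop := local_maps T p' idfun.

Definition strong_complements (W W' : submodClosed V) : Prop :=
  exists d : direct_sum W W',
    let p := incl W \o proj d in let p' := incl W' \o proj (direct_sumC d) in
    [\/ cond1 p p', cond2 p, cond3 p p' | cond4 p'].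

End StrongComplement.
End Locality.

Arguments sub_rel {K V} T W x y.
Arguments quot_rel {K V} T W a b.

(* Main.v *)
Require Import Defs.
From HB Require Import structures.
From mathcomp Require Import all_boot all_algebra.
From mathcomp Require Import boolp classical_sets reals complex.

(** Since polar sets are subspaces, a locality is exactly a symmetric relation
    that is linear in each argument separately ([localityP]).  Write [p], [p']
    for the two projections seen as endomorphisms of [V], so that
    [v = p v + p' v].  Separate linearity lets one add and subtract in one slot:
    if [x] is related to [y] and [p x] to [y], then so is [p' x = x - p x].  This
    gives the symmetry [local_id_complement] between the second and fourth
    conditions; each of these yields locality of [p] or [p'] with itself
    and with the other projection by applying the map in one argument, then in
    the other, and is recovered from it by summing the two components of the
    second argument.

    For the quotient, the class of [v] modulo [W] contains [p' v], hence
    [p'] induces a linear bijection from [V / W] to [W'], inverse to the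
    restriction of the quotient map.  The inverse is always local, because
    related elements of [W'] are themselves representatives of their classes.
    The bijection itself is local because [p'] is local with itself.  Finally
    [V / W] is a locality space because being one is invariant under isomorphism
    and passes to subspaces, both being cases of pulling a relation back along a
    linear map ([locality_pullback]). *)

Set Implicit Arguments.
Unset Strict Implicit.
Unset Printing Implicit Defensive.

Import GRing.Theory.
Local Open Scope ring_scope.

(** * Locality relations *)

(** An arbitrary polar set is the intersection of the polars of points,
    so linearity need only be tested at one point at a time. *)
Lemma localityP (K : fieldType) (V : lmodType K) (T : V -> V -> Prop) :
  locality T <->
  [/\ forall x y, T x y -> T y x, forall u, T 0 u
    & forall k x y u, T x u -> T y u -> T (k *: x + y) u].
Proof.
split=> [[_ sT pT]|[sT T0 TL]].
  have polar1 (u x : V) : (x \in polar T [set u]%classic) <-> T x u.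
    by rewrite in_setE; split=> [Txu|Txu _ ->]; [apply: Txu|].
  split=> // [u|k x y u Tx Ty]; apply/polar1; have [c0 cL] := pT [set u]%classic.
    exact: c0.
  by apply: cL; apply/polar1.
split=> // U; split=> [|k x y]; rewrite !in_setE.
  by move=> u _; apply: T0.
by move=> Tx Ty u Uu; apply: TL; [apply: Tx|apply: Ty].
Qed.

Lemma locality_pullback (K : fieldType) (V V' : lmodType K)
    (T' : V' -> V' -> Prop) (f : {linear V -> V'}) :
  locality T' -> locality (fun x y => T' (f x) (f y)).
Proof.
move=> /localityP[sT T0 TL]; apply/localityP.
split=> [x y|u|k x y u Tx Ty]; first exact: sT.
  by rewrite linear0; apply: T0.
by rewrite linearP; apply: TL.
Qed.

Lemma isomorphic_locality (K : fieldType) (V V' : lmodType K)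
    (T : V -> V -> Prop) (T' : V' -> V' -> Prop) :
  locality_isomorphic T T' -> locality T' -> locality T.
Proof.
case=> f [g [fK _ fT gT]] /(locality_pullback f).
congr locality; apply/funext=> x; apply/funext=> y; apply/propext.
by split=> [/gT|/fT //]; rewrite !fK.
Qed.

(** * Equivalent conditions for a splitting of the identity *)

Section Splitting.
Variables (K : fieldType) (V : lmodType K) (T : V -> V -> Prop).
Hypothesis hT : locality T.

Lemma locality_sym x y : T x y -> T y x.
Proof. by case: hT => _ sT _; apply: sT. Qed.

Lemma localityDr x y z : T x y -> T x z -> T x (y + z).
Proof.
have [sT _ TL] := (localityP T).1 hT.
by move=> /sT Ty /sT Tz; apply: sT; rewrite -[y]scale1r; apply: TL.
Qed.

Lemma localityBl x y z : T x z -> T y z -> T (x - y) z.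
Proof.
have [_ _ TL] := (localityP T).1 hT.
by move=> Tx Ty; rewrite addrC -scaleN1r; apply: TL.
Qed.

Lemma local_maps_sym f f' : local_maps T f f' -> local_maps T f' f.
Proof. by move=> lf x y /locality_sym /lf /locality_sym. Qed.

(** Locality with the identity allows a map to be applied to one argument of a
    related pair and leave the other alone, so [f] and [f'] may be applied
    in turn, one on each side. *)
Lemma local_id_comp f f' :
  local_maps T f idfun -> local_maps T f' idfun -> local_maps T f f'.
Proof.
move=> lf /local_maps_sym lf' x y Txy.
exact: lf' (lf _ _ Txy).
Qed.

Section Sum.
Variables (p p' : V -> V).
Hypothesis pD : forall v, v = p v + p' v.

Lemma local_id_complement : local_maps T p idfun -> local_maps T p' idfun.
Proof.
move=> lp x y Txy.
have -> : p' x = x - p x by rewrite {2}[x]pD addrAC subrr add0r.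
exact: localityBl (lp _ _ Txy).
Qed.

Lemma local_id_sum (f : V -> V) :
  local_maps T f p -> local_maps T f p' -> local_maps T f idfun.
Proof.
move=> fp fp' x y Txy; rewrite /= [y]pD.
by apply: localityDr; [apply: fp|apply: fp'].
Qed.

End Sum.

Lemma splitting_conditions (p p' : V -> V) : (forall v, v = p v + p' v) ->
  [<-> cond1 T p p'; cond2 T p; cond3 T p p'; cond4 T p'].
Proof.
move=> pD; have p'D v : v = p' v + p v by rewrite addrC.
tfae=> [[]|lp|[lp' /local_maps_sym lpp']|lp'].
- exact: local_id_sum.
- have lp' := local_id_complement pD lp.
  by split; apply: local_id_comp.
- exact: (local_id_sum pD).
- have lp := local_id_complement p'D lp'.
  by split; apply: local_id_comp.
Qed.

End Splitting.

(** * Direct sums and quotients *)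

Section DirectSumTheory.
Variables (K : fieldType) (V : lmodType K) (W W' : submodClosed V).
Variable d : direct_sum W W'.

Lemma proj_incl (w : subspace W) : proj d (incl W w) = w.
Proof. by apply: proj_unique; rewrite subrr rpred0. Qed.

(** The element [v - proj d v] lies in [W'] and differs from [v] by an element
    of [W], which is the property that determines the projection onto [W']. *)
Lemma proj_sum v : v = incl W (proj d v) + incl W' (proj (direct_sumC d) v).
Proof.
have -> : proj (direct_sumC d) v = Subspace (projP d v).
  by apply: proj_unique; rewrite /= subKr inclP.
by rewrite /= addrC subrK.
Qed.

Lemma proj_eq0 v : proj (direct_sumC d) v = 0 <-> v \in W.
Proof.
split=> [v0|vW]; last by apply: proj_unique; rewrite [incl _ _]linear0 subr0.
by rewrite [v]proj_sum v0 linear0 addr0 inclP.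
Qed.

Lemma short_exact_direct_sum : short_exact (incl W) (proj (direct_sumC d)).
Proof.
split; first exact: can_inj proj_incl.
  apply/seteqP; split=> [_ [w _ <-]|v /proj_eq0 vW] /=.
    by apply/proj_eq0; apply: inclP.
  by exists (Subspace vW).
apply/seteqP; split=> // w _; exists (incl W' w) => //.
by apply: proj_unique; rewrite subrr rpred0.
Qed.

End DirectSumTheory.

Lemma qspace_factor (K : fieldType) (V U : lmodType K) (W : submodClosed V)
    (f : {linear V -> U}) : (forall v, v \in W -> f v = 0) ->
  exists h : {linear qspace W -> U}, forall v, h (qclass W v) = f v.
Proof.
move=> fW0; pose h a := f (sval (cid (qclass_surj (W := W) a))).
have hE v : h (qclass W v) = f v.
  rewrite /h; case: cid => u /= /qclassP /fW0.
  by rewrite linearB => /subr0_eq.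
have h_linear : linear h.
  move=> k a b; case: (qclass_surj a) (qclass_surj b) => u <- [v <-].
  by rewrite -linearP !hE linearP.
pose hL := GRing.isLinear.Build K (qspace W) U *:%R h h_linear.
by exists (HB.pack h hL : {linear qspace W -> U}).
Qed.

(** The isomorphism is the map induced by the projection onto [W'].  Related
    classes have related representatives [u] and [v], which it sends to [p' u]
    and [p' v]; the hypothesis says that these are related again. *)
Lemma quotient_isomorphic_complement (K : fieldType) (V : lmodType K)
    (T : V -> V -> Prop) (W W' : submodClosed V) (d : direct_sum W W')
    (p' := incl W' \o proj (direct_sumC d)) :
  local_maps T p' p' -> locality_isomorphic (quot_rel T W) (sub_rel T W').
Proof.
move=> lp'.
have [v vW|f fE] := qspace_factor (W := W) (f := proj (direct_sumC d)).
  exact/(proj_eq0 d).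
exists f, (qclass W \o incl W' : {linear _ -> _}); split=> [a|w|a b|w x Twx].
- have [v <-] := qclass_surj a; rewrite fE /=; apply/qclassP.
  by rewrite -opprB subspaceN ?projP.
- by rewrite /= fE; apply: proj_incl.
- by case=> u [v [<- <- Tuv]]; rewrite !fE; apply: lp'.
- by exists (incl W' w), (incl W' x).
Qed.

Theorem corollary6p4 (R : realType) (g : ground)
    (V : lmodType (ground_field R g)) (T : V -> V -> Prop) (hT : locality T)
    (W W' : submodClosed V) (d : direct_sum W W') :
  let pi : {linear V -> subspace W} := proj d in
  let pi' : {linear V -> subspace W'} := proj (direct_sumC d) in
  let p : V -> V := incl W \o pi in
  let p' : V -> V := incl W' \o pi' in
  [/\ [/\ short_exact (incl W) pi', pi \o incl W = id
        & forall v : V, v = p v + p' v],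
      [<-> strong_complements T W W';
           cond1 T p p'; cond2 T p; cond3 T p p'; cond4 T p']
    & strong_complements T W W' ->
      [/\ locality (quot_rel T W), locality (sub_rel T W')
        & locality_isomorphic (quot_rel T W) (sub_rel T W')]].
Proof.
move=> pi pi' p p'.
have conds := splitting_conditions hT (proj_sum d).
have strong_cond1 : strong_complements T W W' -> cond1 T p p'.
  (* The projections depend on the decomposition only through a proof. *)
  case=> d'; rewrite (Prop_irrelevance d' d) /=.
  case=> // [c2|c3|c4]; first exact: (conds 0 1).2.
    exact: (conds 0 2).2.
  exact: (conds 0 3).2.
split.
- split; [exact: short_exact_direct_sum| |exact: proj_sum].
  by apply/funext=> w; apply: proj_incl.
- tfae=> //; [exact: (conds 0 1).1|exact: (conds 1 2).1|exact: (conds 2 3).1|].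
  by move=> c4; exists d; constructor 4.
move=> /strong_cond1 /(conds 0 2)[lp' _].
have iso := quotient_isomorphic_complement lp'.
have sub_loc : locality (sub_rel T W') := locality_pullback (incl W') hT.
by split=> //; apply: isomorphic_locality iso sub_loc.
Qed.
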